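(* For $\lambda\in(0,\infty)$, let $\Delta_\phi$ be the friendship bias of the root of the Galton-Watson tree with Poisson($\lambda$) offspring distribution. Then for every $\lambda\in(0,\infty)$, $$\mathbb P\{\Delta_\phi\ge x\}\sim\mathbb P\{d_\phi=1\}\,\mathbb P\{d_1\ge x\},\qquad x\to\infty.$$ In particular, $$\mathbb P\{\Delta_\phi\ge x\}\sim\frac1{\sqrt{2\pi x}}\,\lambda\,e^{-2\lambda}\exp\Big\{-x\log\Big(\frac{x}{\lambda e}\Big)\Big\},\qquad x\to\infty.$$
   Context: Let $d_\phi$ be the number of children of the root $\phi$ and $d_j$ the number of children of the $j$-th child of the root; here $d_\phi,d_1,d_2,\ldots$ are i.i.d. Poisson($\lambda$) random variables. The friendship bias of the root is $$\Delta_\phi=\Big[\frac1{d_\phi}\sum_{j=1}^{d_\phi}(d_j+1)-d_\phi\Big]\mathbb 1_{\{d_\phi\ne0\}}$$ (so $\Delta_\phi=0$ when $d_\phi=0$). This tree is the local limit of the homogeneous Erdős-Rényi random graph with edge probability $\frac\lambda n\wedge1$. The notation $a_x\sim b_x$, $x\to\infty$, means $\lim_{x\to\infty}a_x/b_x=1$.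
   Formalization: The second (explicit) asymptotic is stated only for x tending to infinity through the integers; for real x it is false, e.g. along x = n - 1/2 the ratio of the two sides tends to 0. The first asymptotic is for real x. *)

(* Defs.v *)
From HB Require Import structures.
From mathcomp Require Import all_boot all_order all_algebra finmap.
From mathcomp Require Import all_classical all_reals all_analysis.

Set Implicit Arguments.
Unset Strict Implicit.
Unset Printing Implicit Defensive.

Import Order.TTheory GRing.Theory Num.Theory.
Import numFieldNormedType.Exports.

Local Open Scope classical_set_scope.
Local Open Scope ring_scope.

Definition prob {d : measure_display} {T : measurableType d} {R : realType}
    (P : probability T R) (A : set T) : R := fine (P A).

(* Mutual independence: the product rule over every finite subfamily. *)
Definition mutually_independent {d d' : measure_display}
    {T : measurableType d} {T' : measurableType d'} {R : realType}
    {P : probability T R} {I : choiceType} (X : I -> {RV P >-> T'}) : Prop :=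
  forall (J : {fset I}) (A : I -> set T'), (forall i, measurable (A i)) ->
    prob P (\bigcap_(i in [set` J]) (X i @^-1` A i)) =
    \prod_(i <- J) prob P (X i @^-1` A i).

(* Ulam-Harris encoding of the Galton-Watson tree: vertices are words over nat,
   [::] is the root, and a vertex u of the tree has the N u children
   rcons u 0, ..., rcons u (N u).-1. The offspring numbers N u are i.i.d.,
   and are also defined for the words u which are not vertices of the tree. *)
Definition poisson_galton_watson {d : measure_display} {T : measurableType d}
    {R : realType} {P : probability T R} (lam : R)
    (N : seq nat -> {RV P >-> nat}) : Prop :=
  mutually_independent N /\
  forall (u : seq nat) (k : nat),
    prob P (N u @^-1` [set k]) = poisson_pmf lam k.

(* The children of the root are labelled from 0, so N [:: j] is the number of
   children of the (j+1)-st one; its degree N [:: j] + 1 also counts the root. *)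
Definition friendship_bias {R : realType} (N : seq nat -> nat) : R :=
  if N [::] == 0%N then 0
  else (\sum_(j < N [::]) (N [:: val j] + 1)%N%:R) / (N [::])%:R - (N [::])%:R.

Definition asymp_equiv {R : realType} {X : Type} (F : set_system X)
    (a b : X -> R) : Prop :=
  (a x / b x) @[x --> F] --> (1 : R).

(* Main.v *)
(* A root with one child has bias d_1, which gives the main term
   P (d_phi = 1) P (d_1 >= x). If the root has d >= 2 children and bias at least
   x, the average of the d_j is at least x + d - 1 >= x + 1, so some d_j is at
   least x + 1. A union bound over j < d, together with independence and
   E d_phi < oo, bounds the probability of this by a multiple of
   P (d_1 >= x + 1) = O (P (d_1 >= x) / x). The explicit form then follows from
   P (d_1 >= n) ~ P (d_1 = n) and Stirling's formula, whose constant is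
   identified by Wallis' formula. *)
Require Import Defs.
From mathcomp Require Import all_boot all_order all_algebra.
From mathcomp Require Import all_classical all_reals all_analysis.
From mathcomp Require Import ring lra finmap.
Import Order.TTheory GRing.Theory Num.Theory.
Import numFieldNormedType.Exports.
Local Open Scope classical_set_scope.
Local Open Scope ring_scope.

(** * Bounds on the logarithm by monotonicity *)

Lemma le_of_is_derive_ge0 {R : realType} {f f' : R -> R} {a b : R} :
  a <= b -> (forall x, a <= x <= b -> is_derive x 1 f (f' x)) ->
  (forall x, a <= x <= b -> 0 <= f' x) -> f a <= f b.
Proof.
move=> ab df f'0.
have [c| |c cab E] := @MVT_segment R f f' a b ab.
- by rewrite in_itv/= => /andP[/ltW ac /ltW cb]; apply: df; rewrite ac cb.
- by apply: derivable_within_continuous => x; rewrite in_itv/= => /df [].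
- by rewrite -subr_ge0 E mulr_ge0 ?subr_ge0// f'0//.
Qed.

(** The right side minus the left vanishes at 1 and has derivative [ln y + 1 / y - 1], which is
    nonnegative since [ln (1 / y) <= 1 / y - 1]. This bound makes [stirling_log] nonincreasing. *)
Lemma ln_ge_pade {R : realType} (x : R) : 1 <= x -> 2 * (x - 1) <= (x + 1) * ln x.
Proof.
move=> x1.
pose f := fun y : R => (y + 1) * ln y - 2 * (y - 1).
suff : f 1 <= f x by rewrite /f ln1 subrr !mulr0 subr0 subr_ge0.
apply: (@le_of_is_derive_ge0 _ _ (fun y => ln y + (y + 1) * y^-1 - 2)) => //.
- move=> y /andP[y1 _].
  have y0 : 0 < y by exact: lt_le_trans y1.
  rewrite /f.
  have dl := is_derive1_ln y0.
  by apply: is_derive_eq; rewrite /GRing.scale/=; lra.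
- move=> y /andP[y1 _].
  have y0 : 0 < y by exact: lt_le_trans y1.
  have := @le_ln1Dx R (y^-1 - 1).
  rewrite ltrBDl subrr invr_gt0 => /(_ y0).
  rewrite addrC subrK lnV ?posrE// mulrDl divff ?gt_eqF//; lra.
Qed.

(** The difference vanishes at 1 and its derivative is the square of [1 - 1 / y]. This bound keeps
    [stirling_log] bounded below. *)
Lemma ln_le_pade {R : realType} (x : R) : 1 <= x -> 2 * ln x <= x - x^-1.
Proof.
move=> x1.
pose f := fun y : R => y - y^-1 - 2 * ln y.
suff : f 1 <= f x by rewrite /f ln1 invr1 subrr mulr0 subr0 subr_ge0.
apply: (@le_of_is_derive_ge0 _ _ (fun y => (1 - y^-1) ^+ 2)) => //.
- move=> y /andP[y1 _].
  have y0 : 0 < y by exact: lt_le_trans y1.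
  have yn0 : y != 0 by rewrite gt_eqF.
  rewrite /f.
  have dl := is_derive1_ln y0.
  have dv := is_deriveV (f := id) yn0 (is_derive_id y 1).
  by apply: is_derive_eq; rewrite /GRing.scale/= -exprVn; ring.
- by move=> y _; rewrite sqr_ge0.
Qed.

(** * Wallis integrals *)

(* The primitive of cos ^ n that vanishes at 0, by the reduction formula, so
   that wallis n below is the integral of cos ^ n over [0, pi / 2]. *)
Fixpoint cos_primitive {R : realType} (n : nat) (x : R) : R :=
  match n with
  | 0 => x
  | 1 => sin x
  | (k.+1 as m).+1 =>
    (cos x ^+ m * sin x + m%:R * cos_primitive k x) / m.+1%:R
  end.

Lemma is_derive_cos_primitive {R : realType} (n : nat) (x : R) :
  is_derive x 1 (cos_primitive n) (cos x ^+ n).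
Proof.
(* The reduction formula lowers the index by two, so the induction carries two consecutive
   indices. *)
suff : is_derive x 1 (cos_primitive n) (cos x ^+ n) /\
       is_derive x 1 (cos_primitive n.+1) (cos x ^+ n.+1) by case.
elim: n => [|n [IHn IHn1]].
  split; first by rewrite expr0; exact: is_derive_id.
  by rewrite expr1; exact: is_derive_sin.
split=> //=.
have ds := is_derive_sin x.
have dc := is_derive_cos x.
have dg := is_deriveZ (n.+2%:R)^-1 (is_deriveD (is_deriveM (is_deriveX n.+1 dc) ds)
  (is_deriveZ n.+1%:R IHn)).
have -> : (fun y : R => (cos y ^+ n.+1 * sin y + n.+1%:R * cos_primitive n y) / n.+2%:R) =
    n.+2%:R^-1 \*: (cos ^+ n.+1 * sin + n.+1%:R \*: cos_primitive n).
  by apply/funext => y; rewrite !fctE /GRing.scale/= mulrC.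
apply: is_derive_eq.
(* Replacing the squared sine that comes from differentiating the power of [cos] leaves only powers
   of [cos], and the terms in [cos x ^+ n] cancel. *)
have s2 : sin x * sin x = 1 - cos x ^+ 2 by rewrite -expr2 sin2cos2.
have n2 : n.+2%:R != 0 :> R by rewrite pnatr_eq0.
apply: (mulfI n2); rewrite /GRing.scale/= fctE mulVKf//.
rewrite [X in _ + X + _](_ : _ = - (n.+1%:R * cos x ^+ n * (sin x * sin x))); last ring.
by rewrite s2 -!natr1 !exprS; ring.
Qed.

Lemma cos_primitive_at0 {R : realType} (n : nat) : cos_primitive n (0 : R) = 0.
Proof.
suff : cos_primitive n (0 : R) = 0 /\ cos_primitive n.+1 (0 : R) = 0 by case.
elim: n => [|n [IHn IHn1]]; first by rewrite /= sin0.
by split=> //=; rewrite IHn sin0 !mulr0 addr0 mul0r.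
Qed.

Definition wallis {R : realType} (n : nat) : R := cos_primitive n (pi / 2).

Lemma wallisS2 {R : realType} (n : nat) :
  n.+2%:R * wallis n.+2 = n.+1%:R * wallis n :> R.
Proof.
by rewrite /wallis/= cos_pihalf expr0n mul0r add0r mulrC divfK// pnatr_eq0.
Qed.

(** On [0, pi / 2] the powers of [cos] decrease with the exponent, so the difference of two
    consecutive primitives is nondecreasing there; it starts at 0. *)
Lemma wallisS_le {R : realType} (n : nat) : wallis n.+1 <= wallis n :> R.
Proof.
have pi2 : 0 <= pi / 2 :> R by rewrite divr_ge0// pi_ge0.
suff : cos_primitive n 0 - cos_primitive n.+1 0 <=
       cos_primitive n (pi / 2) - cos_primitive n.+1 (pi / 2) :> R.
  by rewrite !cos_primitive_at0 subrr subr_ge0.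
apply: (@le_of_is_derive_ge0 _ (cos_primitive n - cos_primitive n.+1)
  (fun x => cos x ^+ n - cos x ^+ n.+1)) => // x xpi.
  by have := is_deriveB (is_derive_cos_primitive n x) (is_derive_cos_primitive n.+1 x).
have c0 : 0 <= cos x by apply: cos_ge0_pihalf; lra.
by rewrite subr_ge0 exprS ler_piMl ?exprn_ge0// cos_le1.
Qed.

(** By [wallisS2] the left side does not depend on [n], and at 0 it is pi / 2. *)
Lemma wallis_mulS {R : realType} (n : nat) :
  n.+1%:R * (wallis n * wallis n.+1) = pi / 2 :> R.
Proof.
elim: n => [|n IHn]; first by rewrite /wallis/= sin_pihalf mul1r mulr1.
by rewrite mulrCA wallisS2 mulrCA [wallis _ * _]mulrC.
Qed.

Lemma wallis_gt0 {R : realType} (n : nat) : 0 < wallis n :> R.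
Proof.
suff : 0 < wallis n :> R /\ 0 < wallis n.+1 :> R by case.
elim: n => [|n [IHn IHn1]].
  by rewrite /wallis/= sin_pihalf divr_gt0// pi_gt0.
split=> //; rewrite -(pmulr_rgt0 _ (ltr0Sn _ n.+1)) wallisS2.
by rewrite mulr_gt0.
Qed.

(** Iterating [wallisS2] from [wallis 0 = pi / 2] produces the central binomial coefficient; this is
    the link between pi and factorials. *)
Lemma wallis_even {R : realType} (n : nat) :
  wallis n.*2 * (4 ^+ n * n`!%:R ^+ 2) = (n.*2)`!%:R * (pi / 2) :> R.
Proof.
elim: n => [|n IHn]; first by rewrite /wallis/= fact0; ring.
apply: (@mulfI _ n.*2.+2%:R); first by rewrite pnatr_eq0.
rewrite doubleS !factS !natrM.
rewrite [LHS]mulrA wallisS2.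
have -> : n.*2.+2%:R = 2 * n.+1%:R :> R by rewrite -doubleS -mul2n natrM.
transitivity (n.*2.+1%:R * 4 * n.+1%:R ^+ 2 * (wallis n.*2 * (4 ^+ n * n`!%:R ^+ 2)) : R).
  by rewrite exprS; ring.
by rewrite IHn; ring.
Qed.

(** * Stirling's formula *)

(* The logarithm of n! / (sqrt n * (n / e) ^ n). *)
Definition stirling_log {R : realType} (n : nat) : R :=
  ln n`!%:R - (n%:R + 2^-1) * ln n%:R + n%:R.

Lemma stirling_logB {R : realType} (n : nat) :
  stirling_log n.+1 - stirling_log n.+2 =
  (n.+1%:R + 2^-1) * ln (n.+2%:R / n.+1%:R) - 1 :> R.
Proof.
rewrite /stirling_log [n.+2`!]factS natrM lnM ?posrE ?ltr0n ?fact_gt0//.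
by rewrite ln_div ?posrE ?ltr0n// -!natr1; ring.
Qed.

Lemma stirling_log_nonincreasing {R : realType} (n : nat) :
  stirling_log n.+2 <= stirling_log n.+1 :> R.
Proof.
rewrite -subr_ge0 stirling_logB subr_ge0.
have n0 : 0 < n.+1%:R :> R by rewrite ltr0n.
have n2 : n.+2%:R / n.+1%:R = 1 + n.+1%:R^-1 :> R.
  by rewrite -natr1 mulrDl divff ?gt_eqF// mul1r.
have x1 : 1 <= n.+2%:R / n.+1%:R :> R by rewrite n2 lerDl invr_ge0 ltW.
have := ln_ge_pade _ x1.
rewrite [X in X - 1]n2 [X in X + 1]n2.
(* At this ratio the bound reads [2 / n.+1 <= (2 + 1 / n.+1) * ln _]; multiplying by [n.+1 / 2]
   gives exactly the required lower bound 1. *)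
have n20 : 0 <= n.+1%:R / 2 :> R by rewrite divr_ge0.
move=> /(ler_wpM2l n20).
suff -> : n.+1%:R / 2 * ((1 + n.+1%:R^-1 + 1) * ln (n.+2%:R / n.+1%:R)) =
    (n.+1%:R + 2^-1) * ln (n.+2%:R / n.+1%:R) :> R.
  apply: le_trans; rewrite le_eqVlt; apply/orP; left; apply/eqP.
  by field; rewrite addrC natr1 gt_eqF.
by field; rewrite addrC natr1 gt_eqF.
Qed.

(* By induction: stirling_log n - 1 / (4 n) is nondecreasing. *)
Lemma stirling_log_bound {R : realType} (n : nat) :
  3 / 4 + (4 * n.+1%:R)^-1 <= stirling_log n.+1 :> R.
Proof.
elim: n => [|n IHn]; first by rewrite /stirling_log -[1`!]/1%N ln1; lra.
apply: le_trans (_ : stirling_log n.+1 - ((4 * n.+1%:R)^-1 - (4 * n.+2%:R)^-1) <= _).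
  rewrite lerBrDl; move: IHn.
  by set a := (4 * n.+1%:R)^-1; set b := (4 * n.+2%:R)^-1; lra.
rewrite lerBlDr -lerBlDl stirling_logB.
have n0 : 0 < n.+1%:R :> R by rewrite ltr0n.
have n0' : 0 < n.+2%:R :> R by rewrite ltr0n.
have x1 : 1 <= n.+2%:R / n.+1%:R :> R.
  by rewrite ler_pdivlMr// mul1r ler_nat.
have := ln_le_pade _ x1.
rewrite -(ler_pM2l (_ : 0 < (n.+1%:R + 2^-1) / 2 :> R)); last first.
  by rewrite divr_gt0// addr_gt0// invr_gt0.
rewrite mulrA divfK// => H; apply: (le_trans (lerB H (lexx 1))).
(* With k = n + 1, both sides equal 1 / (4 k (k + 1)). *)
rewrite le_eqVlt; apply/orP; left; apply/eqP.
rewrite invf_div -natr1.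
by field; rewrite ?natr1 ?gt_eqF.
Qed.

(** Squaring avoids the root of [n] and matches the squared factorial in [wallis_even]. *)
Lemma sqr_factE {R : realType} (n : nat) : (0 < n)%N ->
  n`!%:R ^+ 2 =
  expR (stirling_log n) ^+ 2 * (n%:R * (n%:R ^+ n / expR 1 ^+ n) ^+ 2) :> R.
Proof.
move=> n0; have nR0 : 0 < n%:R :> R by rewrite ltr0n.
have fE : n`!%:R = expR (ln n`!%:R) :> R by rewrite lnK// posrE ltr0n fact_gt0.
have nE : n%:R = expR (ln n%:R) :> R by rewrite lnK.
rewrite exprMn [in X in _ = _ * X]nE fE -!expRM_natl -expRN -!expRM_natl -!expRD /stirling_log.
by congr expR; field.
Qed.

(** Monotonicity puts the square between the products of [wallis n.*2] with its two neighbours,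
    which [wallis_mulS] evaluates. The upper bound is exactly pi / 4, the lower one pi / 4 times 2n
    / (2n + 1). *)
Lemma cvg_wallis_sqr {R : realType} :
  n%:R * wallis n.*2 ^+ 2 @[n --> \oo] --> (pi / 4 : R).
Proof.
apply: (@squeeze_cvgr _ _ _ _ (fun n => pi / 4 * (1 - harmonic n)) (fun=> pi / 4)).
- near=> n.
  have n0 : (0 < n)%N by near: n; exists 1%N.
  have W0 := @wallis_gt0 R n.*2.
  apply/andP; split.
    have : wallis n.*2 * wallis n.*2.+1 <= wallis n.*2 ^+ 2 :> R.
      by rewrite expr2 ler_pM2l// wallisS_le.
    move=> /(ler_wpM2l (ler0n R n)); apply: le_trans.
    have -> : wallis n.*2 * wallis n.*2.+1 = n.*2.+1%:R^-1 * (pi / 2) :> R.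
      by rewrite -(wallis_mulS n.*2) mulKf// pnatr_eq0.
    rewrite [leRHS](_ : _ = pi / 4 * (2 * n%:R / n.*2.+1%:R)); last by field.
    rewrite ler_pM2l ?divr_gt0 ?pi_gt0// /harmonic/= ler_pdivlMr ?ltr0n//.
    rewrite mulrBl mul1r lerBlDr -[n.*2.+1%:R]natr1 -mul2n natrM lerD2l.
    rewrite mulrC ler_pdivlMr ?ltr0n// mul1r -natr1.
    by rewrite lerD2r ler_peMl// ler1n.
  clear -n0 W0; case: n n0 W0 => // n _ W0.
  have : wallis n.+1.*2 ^+ 2 <= wallis n.*2.+1 * wallis n.*2.+2 :> R.
    by rewrite expr2 doubleS ler_pM2r// wallisS_le.
  move=> /(ler_wpM2l (ler0n R n.+1)) /le_trans; apply.
  have -> : pi / 4 = (pi / 2) / 2 :> R by field.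
  rewrite -(wallis_mulS n.*2.+1) (_ : n.*2.+2%:R = 2 * n.+1%:R); last first.
    by rewrite -doubleS -mul2n natrM.
  by rewrite le_eqVlt; apply/orP; left; apply/eqP; field.
- have : pi / 4 * (1 - harmonic n) @[n --> \oo] --> pi / 4 * (1 - 0 : R).
    by apply: cvgM; [exact: cvg_cst|apply: cvgB; [exact: cvg_cst|exact: cvg_harmonic]].
  by rewrite subr0 mulr1.
- exact: cvg_cst.
Unshelve. all: by end_near.
Qed.

(** This is the square of [wallis_even] with the factorials written through [sqr_factE]. All powers
    of n / e cancel, since (2n / e) ^ (2n) is 4 ^ n times the square of (n / e) ^ n. *)
Lemma wallis_stirling_log {R : realType} (n : nat) : (0 < n)%N ->
  n%:R * wallis n.*2 ^+ 2 * expR (stirling_log n) ^+ 4 =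
  expR (stirling_log n.*2) ^+ 2 * (pi ^+ 2 / 2) :> R.
Proof.
move=> n0; have nR0 : 0 < n%:R :> R by rewrite ltr0n.
have n20 : (0 < n.*2)%N by rewrite double_gt0.
have := congr1 (fun x => x ^+ 2) (@wallis_even R n).
have E : (n.*2%:R ^+ n.*2 / expR 1 ^+ n.*2) = 4 ^+ n * (n%:R ^+ n / expR 1 ^+ n) ^+ 2 :> R.
  rewrite -!mul2n natrM exprMn !exprM (_ : 2 ^+ 2 = 4 :> R); last by ring.
  by rewrite expr_div_n -!exprM mulnC !mulrA.
rewrite /= [RHS]exprMn (sqr_factE _ n0) (sqr_factE _ n20) E -mul2n natrM mul2n.
set z := n%:R ^+ n / _; have z0 : z != 0 by rewrite gt_eqF// divr_gt0// exprn_gt0// expR_gt0.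
have f0 : 4 ^+ n != 0 :> R by rewrite expf_neq0.
set W := wallis _; set A := expR _; set B := expR _.
move=> H; apply: (@mulfI _ (n%:R * (4 ^+ n) ^+ 2 * z ^+ 4)).
  by rewrite !mulf_neq0 ?expf_neq0// gt_eqF.
transitivity ((W * (4 ^+ n * (A ^+ 2 * (n%:R * z ^+ 2)))) ^+ 2); first by ring.
by rewrite H; field.
Qed.

Lemma cvg_stirling_log {R : realType} :
  expR (stirling_log n) @[n --> \oo] --> (Num.sqrt (2 * pi) : R).
Proof.
(* Index 0 is skipped: [ln 0 = 0] by convention, and monotonicity fails there. *)
have cu : cvgn (fun n => stirling_log n.+1 : R).
  apply: nonincreasing_is_cvgn.
    by apply/nonincreasing_seqP => n; exact: stirling_log_nonincreasing.
  exists 0 => _ [n _ <-]; apply: le_trans (stirling_log_bound n).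
  by rewrite addr_ge0// invr_ge0 mulr_ge0.
set L := limn _ in cu.
have uL : stirling_log n @[n --> \oo] --> L.
  by rewrite -(cvg_shiftS (fun n => stirling_log n : R)).
have eL : expR (stirling_log n) @[n --> \oo] --> expR L.
  by apply: continuous_cvg => //; exact: continuous_expR.
have e2L : expR (stirling_log n.*2) @[n --> \oo] --> expR L.
  under eq_cvg do rewrite -muln2.
  exact: (cvg_comp _ _ (@cvg_mulnr 2 isT) eL).
(* Both sides of [wallis_stirling_log] are passed to the limit; cancelling [expR L ^+ 2] then forces
   [expR L ^+ 2 = 2 * pi]. *)
have E : pi / 4 * expR L ^+ 4 = expR L ^+ 2 * (pi ^+ 2 / 2) :> R.
  have l : n%:R * wallis n.*2 ^+ 2 * expR (stirling_log n) ^+ 4 @[n --> \oo] -->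
      pi / 4 * expR L ^+ 4.
    apply: cvgM; first exact: cvg_wallis_sqr.
    exact: (cvg_comp _ _ eL (@exprn_continuous R 4 (expR L))).
  have r : expR (stirling_log n.*2) ^+ 2 * (pi ^+ 2 / 2) @[n --> \oo] -->
      expR L ^+ 2 * (pi ^+ 2 / 2).
    by apply: cvgMl; exact: (cvg_comp _ _ e2L (@exprn_continuous R 2 (expR L))).
  have l' : n%:R * wallis n.*2 ^+ 2 * expR (stirling_log n) ^+ 4 @[n --> \oo] -->
      expR L ^+ 2 * (pi ^+ 2 / 2).
    apply: cvg_trans r; apply: near_eq_cvg; exists 1%N => // n n0.
    exact/esym/wallis_stirling_log.
  by rewrite -(cvg_lim (@norm_hausdorff _ R) l) -(cvg_lim (@norm_hausdorff _ R) l').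
suff -> : Num.sqrt (2 * pi) = expR L by [].
have L0 := expR_gt0 L.
rewrite -[RHS]ger0_norm ?ltW// -sqrtr_sqr; congr Num.sqrt.
apply: (@mulfI _ (pi / 4 * expR L ^+ 2)).
  by rewrite gt_eqF// mulr_gt0 ?exprn_gt0// divr_gt0// pi_gt0.
by transitivity (pi / 4 * expR L ^+ 4); [rewrite E; field|ring].
Qed.

(** * Poisson tails *)

Definition poisson_tail {R : realType} (lam : R) (n : nat) : R :=
  1 - \sum_(k < n) poisson_pmf lam k.

Lemma poisson_tail0 {R : realType} {lam : R} : poisson_tail lam 0 = 1.
Proof. by rewrite /poisson_tail big_ord0 subr0. Qed.

Lemma poisson_tailE {R : realType} {lam : R} (n : nat) :
  poisson_tail lam n = poisson_pmf lam n + poisson_tail lam n.+1.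
Proof. by rewrite /poisson_tail big_ord_recr/=; ring. Qed.

Lemma poisson_pmf_gt0 {R : realType} {lam : R} (n : nat) :
  0 < lam -> 0 < poisson_pmf lam n.
Proof.
move=> l0; rewrite /poisson_pmf l0.
by rewrite mulr_gt0 ?expR_gt0// divr_gt0 ?exprn_gt0// ltr0n fact_gt0.
Qed.

Lemma poisson_pmfS {R : realType} {lam : R} (n : nat) : 0 < lam ->
  poisson_pmf lam n.+1 = lam / n.+1%:R * poisson_pmf lam n.
Proof.
move=> l0; rewrite /poisson_pmf l0 factS natrM exprS.
have f0 : n`!%:R != 0 :> R by rewrite pnatr_eq0 -lt0n fact_gt0.
by field; rewrite f0 addrC natr1 pnatr_eq0.
Qed.

Lemma cvg_poisson_tail {R : realType} {lam : R} : 0 < lam ->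
  poisson_tail lam n @[n --> \oo] --> (0 : R).
Proof.
move=> l0.
have H : 1 - series (exp_coeff lam) n * expR (- lam) @[n --> \oo] -->
    1 - expR lam * expR (- lam).
  apply: cvgB; first exact: cvg_cst.
  by apply: cvgMl; exact: is_cvg_series_exp_coeff.
rewrite expRxMexpNx_1 subrr in H.
apply: cvg_trans H; apply: near_eq_cvg; apply: nearW => n.
rewrite /poisson_tail /series/= big_mkord mulr_suml; congr (1 - _).
by apply: eq_bigr => i _; rewrite /poisson_pmf l0.
Qed.

Lemma poisson_tail_ge0 {R : realType} {lam : R} (n : nat) : 0 < lam ->
  0 <= poisson_tail lam n.
Proof.
move=> l0; have tl := cvg_poisson_tail l0.
rewrite -(cvg_lim (@norm_hausdorff _ R) tl).
apply: nonincreasing_cvgn_ge; last by apply/cvg_ex; exists 0.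
apply/nonincreasing_seqP => k.
by rewrite [leRHS]poisson_tailE lerDr ltW// poisson_pmf_gt0.
Qed.

Lemma poisson_tail_gt0 {R : realType} {lam : R} (n : nat) : 0 < lam ->
  0 < poisson_tail lam n.
Proof.
by move=> l0; rewrite poisson_tailE ltr_pwDl ?poisson_pmf_gt0 ?poisson_tail_ge0.
Qed.

(* The difference of the two sides is nonincreasing in n and tends to 0. *)
Lemma poisson_tailS_le {R : realType} {lam : R} (n : nat) : 0 < lam ->
  poisson_tail lam n.+1 <= lam / n.+1%:R * poisson_tail lam n.
Proof.
move=> l0; rewrite -subr_ge0.
pose G k : R := lam / k.+1%:R * poisson_tail lam k - poisson_tail lam k.+1.
have G0 : G k @[k --> \oo] --> (0 : R).
  have -> : 0 = lam * 0 * 0 - 0 :> R by rewrite !mulr0 subr0.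
  apply: cvgB; last first.
    by rewrite (cvg_shiftS (poisson_tail lam)); exact: cvg_poisson_tail.
  apply: cvgM; last exact: cvg_poisson_tail.
  by apply: cvgM; [exact: cvg_cst|exact: cvg_harmonic].
change (0 <= G n).
rewrite -(cvg_lim (@norm_hausdorff _ R) G0).
apply: nonincreasing_cvgn_ge; last by apply/cvg_ex; exists 0.
apply/nonincreasing_seqP => k; rewrite /G.
(* Splitting off the first mass of each tail, the two masses cancel by [poisson_pmfS]. What remains
   differs from [G k.+1] only in the larger factor [lam / k.+1]. *)
have -> : lam / k.+1%:R * poisson_tail lam k - poisson_tail lam k.+1 =
    lam / k.+1%:R * poisson_tail lam k.+1 - poisson_tail lam k.+2.
  rewrite [poisson_tail lam k]poisson_tailE mulrDr -poisson_pmfS//.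
  by rewrite [X in _ + _ - X]poisson_tailE; ring.
rewrite lerD2r ler_wpM2r ?poisson_tail_ge0// ler_wpM2l ?(ltW l0)//.
by rewrite lef_pV2 ?posrE ?ltr0n// ler_nat.
Qed.

Lemma poisson_tail_le {R : realType} {lam : R} (n : nat) : 0 < lam ->
  poisson_tail lam n <= lam ^+ n / n`!%:R.
Proof.
move=> l0; elim: n => [|n IHn]; first by rewrite poisson_tail0 fact0 divr1.
apply: le_trans (poisson_tailS_le _ l0) _.
have -> : lam ^+ n.+1 / n.+1`!%:R = lam / n.+1%:R * (lam ^+ n / n`!%:R).
  by rewrite factS natrM invfM exprS; ring.
by rewrite ler_wpM2l// divr_ge0// ltW.
Qed.

(** These sums are bounded by the mean offspring number. Any bound uniform in [n] suffices, and
    comparison with the exponential series gives one at once. *)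
Lemma sum_poisson_tailS_le {R : realType} {lam : R} (n : nat) : 0 < lam ->
  \sum_(j < n) poisson_tail lam j.+1 <= expR lam.
Proof.
move=> l0; apply: (@le_trans _ _ (series (exp_coeff lam) n.+1)).
  rewrite /series/= big_mkord big_ord_recl/= -[leLHS]add0r lerD//.
    by rewrite /exp_coeff/= divr_ge0.
  by apply: ler_sum => i _; exact: poisson_tail_le.
apply: nondecreasing_cvgn_le; last exact: is_cvg_series_exp_coeff.
apply/nondecreasing_seqP => k; rewrite /series/= big_nat_recr//= lerDl.
by rewrite divr_ge0// exprn_ge0// ltW.
Qed.

(** Combining [poisson_tailE] with [poisson_tailS_le] gives [(1 - lam / n.+1) * poisson_tail lam n
    <= poisson_pmf lam n] for every [n]; the factor is positive for large [n] and tends to 1. *)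
Lemma poisson_tail_equiv {R : realType} {lam : R} : 0 < lam ->
  asymp_equiv \oo (poisson_tail lam) (poisson_pmf lam).
Proof.
move=> l0; rewrite /asymp_equiv.
have H : (1 - lam * harmonic n)^-1 @[n --> \oo] --> (1 - lam * 0 : R)^-1.
  apply: cvgV; first by rewrite mulr0 subr0 oner_neq0.
  by apply: cvgB; [exact: cvg_cst|apply: cvgM; [exact: cvg_cst|exact: cvg_harmonic]].
rewrite mulr0 subr0 invr1 in H.
apply: (@squeeze_cvgr _ _ _ _ (fun=> 1) (fun n => (1 - lam * harmonic n)^-1)) => //;
  last exact: cvg_cst.
near=> n.
have p0 := poisson_pmf_gt0 n l0.
have t0 := poisson_tail_gt0 n l0.
have h1 : 0 < 1 - lam * harmonic n.
  rewrite subr_gt0 /harmonic/= ltr_pdivrMr ?ltr0n// mul1r.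
  apply: lt_le_trans (_ : n%:R <= _); last by rewrite ler_nat.
  by near: n; exact: nbhs_infty_gtr.
apply/andP; split.
  by rewrite ler_pdivlMr// mul1r poisson_tailE lerDl poisson_tail_ge0.
rewrite ler_pdivrMr// -(ler_pM2l h1) mulVKf ?gt_eqF//.
have := poisson_tailS_le n l0.
have := @poisson_tailE R lam n; rewrite /harmonic/= mulrBl mul1r; set a := lam / _ * _; lra.
Unshelve. all: by end_near.
Qed.

(** * Laws and independence of the offspring numbers *)

Lemma probE {d : measure_display} {T : measurableType d} {R : realType}
    (P : probability T R) (A : set T) : measurable A -> (prob P A)%:E = P A.
Proof. by move=> mA; rewrite /prob fineK// fin_num_measure. Qed.

Lemma measurable_nat_preimage {d : measure_display} {T : measurableType d}
    {R : realType} {P : probability T R} (X : {RV P >-> nat}) (A : set nat) :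
  measurable (X @^-1` A).
Proof. by rewrite -[X in measurable X]setTI; exact: measurable_funP. Qed.

Lemma independent_pair {d d' : measure_display}
    {T : measurableType d} {T' : measurableType d'} {R : realType}
    {P : probability T R} {I : choiceType} (X : I -> {RV P >-> T'})
    (i j : I) (A B : set T') :
  mutually_independent X -> i != j -> measurable A -> measurable B ->
  prob P (X i @^-1` A `&` X j @^-1` B) =
  prob P (X i @^-1` A) * prob P (X j @^-1` B).
Proof.
move=> indX ij mA mB.
have := indX [fset i; j]%fset (fun k => if k == i then A else B).
rewrite big_fsetU1 ?inE//= big_seq_fset1 eqxx eq_sym (negbTE ij) => <-;
  last by move=> k; case: ifP.
congr (prob P _); apply/seteqP; split => w /=.
  move=> [Aw Bw] k /=; rewrite !inE => /orP[] /eqP ->; rewrite ?eqxx//.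
  by rewrite eq_sym (negbTE ij).
move=> Xw; split.
  by have := Xw i; rewrite /= !inE eqxx; apply.
by have := Xw j; rewrite /= !inE eqxx orbT [j == i]eq_sym (negbTE ij); apply.
Qed.

Lemma prob_offspring_ge {d : measure_display} {T : measurableType d}
    {R : realType} {P : probability T R} {lam : R} {N : seq nat -> {RV P >-> nat}}
    (hN : poisson_galton_watson lam N) (u : seq nat) (n : nat) :
  prob P (N u @^-1` [set k | (n <= k)%N]) = poisson_tail lam n.
Proof.
elim: n => [|n IHn].
  rewrite poisson_tail0 (_ : _ @^-1` _ = setT) ?/prob ?probability_setT//.
  exact/seteqP.
have E : N u @^-1` [set k | (n <= k)%N] =
    N u @^-1` [set n] `|` N u @^-1` [set k | (n.+1 <= k)%N].
  apply/seteqP; split => w /=; last by move=> [->|/ltnW].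
  by rewrite leq_eqVlt => /orP[/eqP|]; [left|right].
move: IHn; rewrite E /prob measureU; last first.
- by apply/seteqP; split => // w /= [-> ]; rewrite ltnn.
- exact: measurable_nat_preimage.
- exact: measurable_nat_preimage.
rewrite fineD ?fin_num_measure//; last 2 first.
- exact: measurable_nat_preimage.
- exact: measurable_nat_preimage.
have := hN.2 u n; rewrite /prob => ->.
by rewrite [RHS]poisson_tailE => /addrI.
Qed.

(** * The event of a large friendship bias *)

Lemma measurable_friendship_bias_ge {d : measure_display} {T : measurableType d}
    {R : realType} {P : probability T R} (N : seq nat -> {RV P >-> nat}) (x : R) :
  measurable [set w | x <= friendship_bias (fun u => N u w)].
Proof.
(* The number of summands is random, so the event is split along the countably many values of [N
   [::]]; for a fixed value the bias is a finite sum of measurable functions. *)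
pose f k w : R := if k == 0%N then 0
  else (\sum_(j < k) (N [:: val j] w + 1)%N%:R) / k%:R - k%:R.
have -> : [set w | x <= friendship_bias (fun u => N u w)] =
    \bigcup_k (N [::] @^-1` [set k] `&` [set w | x <= f k w]).
  apply/seteqP; split => w /=; first by move=> xw; exists (N [::] w).
  by move=> [k _ [/= <-]].
apply: bigcupT_measurable => k; apply: measurableI; first exact: measurable_nat_preimage.
have mf : measurable_fun setT (f k).
  rewrite /f; case: eqP => _; first exact: measurable_cst.
  apply: measurable_realfun.measurable_funB => //.
  apply: measurable_realfun.measurable_funM => //.
  apply: measurable_sum => j.
  rewrite (_ : (fun w => _) = (fun m : nat => (m + 1)%:R) \o N [:: val j])//.
  by apply: measurableT_comp.
rewrite (_ : [set w | _] = setT `&` f k @^-1` `[x, +oo[).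
  exact: mf.
by apply/seteqP; split => w /=; rewrite in_itv/= andbT => //; case.
Qed.

(* The largest of the numbers of children is at least their average, which
   exceeds m when the root has at least two children. *)
Lemma friendship_bias_ge_sub {d : measure_display} {T : measurableType d}
    {R : realType} {P : probability T R} (N : seq nat -> {RV P >-> nat})
    (x : R) (m : nat) : 0 < x ->
  (forall k : nat, (x <= k%:R) = (m <= k)%N) ->
  [set w | x <= friendship_bias (fun u => N u w)] `<=`
    (N [::] @^-1` [set 1%N] `&` N [:: 0%N] @^-1` [set k | (m <= k)%N]) `|`
    \bigcup_j (N [::] @^-1` [set k | (j < k)%N] `&`
               N [:: j] @^-1` [set k | (m < k)%N]).
Proof.
move=> x0 xm w /=; rewrite /friendship_bias.
case: eqP => [_|/eqP]; first by rewrite leNgt x0.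
case Nw : (N [::] w) => [//|[|n]] _ xle.
  left; split=> //.
  by move: xle; rewrite big_ord_recl big_ord0 natrD /= divr1 addr0 addrK xm.
right; apply: contrapT => notj.
have small (j : 'I_n.+2) : (N [:: val j] w + 1)%N%:R <= m%:R + 1 :> R.
  rewrite natrD lerD2r ler_nat leqNgt; apply/negP => mj; apply: notj.
  by exists (val j); rewrite //= Nw.
have m0 : (0 < m)%N by rewrite ltnNge -xm -ltNge.
(* The hypothesis makes [m] the least natural number at or above [x], so [m - 1 < x]. *)
have mx : m%:R < x + 1.
  by rewrite -(prednK m0) -natr1 ltrD2r ltNge xm -ltnNge ltn_predL.
have : \sum_(j < n.+2) (N [:: val j] w + 1)%N%:R <= n.+2%:R * (m%:R + 1) :> R.
  apply: le_trans (ler_sum _ (fun j _ => small j)) _.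
  by rewrite sumr_const card_ord mulr_natl.
(* The average of the degrees is at most [m + 1 < x + 2], while a bias of at least [x] with two or
   more children requires an average of at least [x + 2]. *)
rewrite -ler_pdivrMl ?ltr0n// mulrC => avg.
move: xle avg.
have : 2 <= n.+2%:R :> R by rewrite ler_nat.
by set a := n.+2%:R; set S := _ / a; lra.
Qed.

(** Union bound over all [j]. By independence the [j]-th event has probability [poisson_tail lam
    j.+1 * poisson_tail lam m.+1]; the first factor, from requiring that child [j] exists, makes the
    sum converge. *)
Lemma prob_offspring_gt_bigcup {d : measure_display} {T : measurableType d}
    {R : realType} {P : probability T R} {lam : R} {N : seq nat -> {RV P >-> nat}}
    (hN : poisson_galton_watson lam N) (m : nat) : 0 < lam ->
  prob P (\bigcup_j (N [::] @^-1` [set k | (j < k)%N] `&`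
                     N [:: j] @^-1` [set k | (m < k)%N])) <=
  expR lam * poisson_tail lam m.+1.
Proof.
move=> l0; set F := fun j : nat => _ `&` _.
have mF j : measurable (F j).
  by apply: measurableI; exact: measurable_nat_preimage.
have mU : measurable (\bigcup_j F j) by exact: bigcupT_measurable.
rewrite -lee_fin probE//.
apply: le_trans (measure_sigma_subadditive P mF mU (fun=> id)) _.
have PF j : P (F j) = (poisson_tail lam j.+1 * poisson_tail lam m.+1)%:E.
  rewrite -probE// independent_pair//; last exact: hN.1.
  by congr (_ * _)%:E; exact: (prob_offspring_ge hN).
apply: lime_le.
  by apply: is_cvg_nneseries => j _ _.
apply: nearW => n.
rewrite (eq_bigr _ (fun i _ => PF i)).
rewrite sumEFin lee_fin -mulr_suml big_mkord ler_wpM2r ?poisson_tail_ge0//.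
exact: sum_poisson_tailS_le.
Qed.

(** The one-child event with [m <= d_1] lies inside the bias event, which gives the lower bound; the
    covering of [friendship_bias_ge_sub] gives the upper one. *)
Lemma prob_friendship_bias_bounds {d : measure_display} {T : measurableType d}
    {R : realType} {P : probability T R} {lam : R} {N : seq nat -> {RV P >-> nat}}
    (hN : poisson_galton_watson lam N) (x : R) (m : nat) : 0 < lam -> 0 < x ->
  (forall k : nat, (x <= k%:R) = (m <= k)%N) ->
  let p := prob P [set w | x <= friendship_bias (fun u => N u w)] in
  let q := poisson_pmf lam 1 * poisson_tail lam m in
  q <= p <= q + expR lam * poisson_tail lam m.+1.
Proof.
move=> l0 x0 xm /=.
have mE := measurable_friendship_bias_ge N x.
set A := N [::] @^-1` [set 1%N] `&` N [:: 0%N] @^-1` [set k | (m <= k)%N].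
have mA : measurable A by apply: measurableI; exact: measurable_nat_preimage.
have mB : measurable (\bigcup_j (N [::] @^-1` [set k | (j < k)%N] `&`
                     N [:: j] @^-1` [set k | (m < k)%N])).
  by apply: bigcupT_measurable => j; apply: measurableI; exact: measurable_nat_preimage.
have -> : poisson_pmf lam 1 * poisson_tail lam m = prob P A.
  rewrite independent_pair//; last exact: hN.1.
  by rewrite hN.2; congr (_ * _); rewrite -(prob_offspring_ge hN [:: 0%N]).
apply/andP; split.
  rewrite -lee_fin !probE//; apply: le_measure; [exact/mem_set|exact/mem_set|].
  move=> w [/= N1 mw]; rewrite /friendship_bias N1/=.
  by rewrite big_ord_recl big_ord0 natrD /= divr1 addr0 addrK xm.
apply: le_trans (lerD (lexx _) (prob_offspring_gt_bigcup hN m l0)).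
rewrite -lee_fin EFinD !probE//.
apply: le_trans (measureU2 _ mA mB).
apply: le_measure; last exact: friendship_bias_ge_sub.
  exact/mem_set.
by apply/mem_set; exact: measurableU.
Qed.

(** * Asymptotic equivalences *)

Lemma absz_ceil_le {R : realType} (x : R) (k : nat) : 0 < x ->
  (x <= k%:R) = (`|Num.ceil x| <= k)%N.
Proof.
move=> x0; rewrite -lez_nat gez0_abs; last by rewrite ceil_ge0 (lt_trans _ x0)// ltrN10.
by rewrite ceil_le_int.
Qed.

Lemma friendship_bias_tail_equiv {d : measure_display} {T : measurableType d}
    {R : realType} {P : probability T R} {lam : R} {N : seq nat -> {RV P >-> nat}} :
  0 < lam -> poisson_galton_watson lam N ->
  asymp_equiv (+oo : set_system R)
    (fun x : R => prob P [set w | x <= friendship_bias (fun u => N u w)])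
    (fun x : R => poisson_pmf lam 1 * poisson_tail lam `|Num.ceil x|).
Proof.
move=> l0 hN; rewrite /asymp_equiv.
have p0 := poisson_pmf_gt0 1 l0.
(* By [poisson_tailS_le] the error term divided by the main term is at most [C / m.+1], hence at
   most [C / x]. *)
pose C := expR lam * lam / poisson_pmf lam 1.
have H : 1 + C * x^-1 @[x --> +oo] --> (1 + C * 0 : R).
  apply: cvgD; first exact: cvg_cst.
  apply: cvgM; first exact: cvg_cst.
  by apply/(@gtr0_cvgV0 R R +oo _ id); [exact: nbhs_pinfty_gt|exact: cvg_id].
rewrite mulr0 addr0 in H.
apply: (@squeeze_cvgr _ _ _ _ (fun=> 1) (fun x => 1 + C * x^-1)) => //; last exact: cvg_cst.
near=> x.
have x0 : 0 < x by near: x; exact: nbhs_pinfty_gt.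
have xm k := @absz_ceil_le _ x k x0.
have := prob_friendship_bias_bounds hN _ _ l0 x0 xm.
set p := prob _ _; set m := `|_|%N => /= /andP[lo hi].
have t0 := poisson_tail_gt0 m l0.
have q0 : 0 < poisson_pmf lam 1 * poisson_tail lam m by rewrite mulr_gt0.
rewrite ler_pdivlMr// mul1r lo/= ler_pdivrMr// (le_trans hi)//.
rewrite mulrDl mul1r lerD2l.
have -> : C * x^-1 * (poisson_pmf lam 1 * poisson_tail lam m) =
    expR lam * (lam / x * poisson_tail lam m).
  by rewrite /C; field; rewrite !gt_eqF.
rewrite ler_wpM2l ?expR_ge0//; apply: le_trans (poisson_tailS_le m l0) _.
rewrite ler_wpM2r ?(ltW t0)// ler_wpM2l ?(ltW l0)// lef_pV2 ?posrE ?ltr0n//.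
by apply: le_trans (_ : m%:R <= _); [rewrite xm|rewrite ler_nat].
Unshelve. all: by end_near.
Qed.

(** An exact identity: the whole deviation from Stirling's approximation sits in [stirling_log], so
    that only its limit is needed later. *)
Lemma poisson_pmf_stirlingE {R : realType} {lam : R} (n : nat) :
  0 < lam -> (0 < n)%N ->
  poisson_pmf lam n = (Num.sqrt n%:R * expR (stirling_log n))^-1 *
    expR (- lam) * expR (- (n%:R * ln (n%:R / (lam * expR 1)))).
Proof.
move=> l0 n0; have nR0 : 0 < n%:R :> R by rewrite ltr0n.
have -> : expR (- (n%:R * ln (n%:R / (lam * expR 1)))) =
    lam ^+ n * (n%:R ^+ n / expR 1 ^+ n)^-1.
  rewrite expRN expRM_natl lnK ?posrE ?divr_gt0 ?mulr_gt0 ?expR_gt0//.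
  by rewrite expr_div_n exprMn; field; rewrite !expf_neq0// gt_eqF// expR_gt0.
rewrite /poisson_pmf l0.
have -> : n`!%:R = expR (stirling_log n) * (Num.sqrt n%:R * (n%:R ^+ n / expR 1 ^+ n)) :> R.
  apply/eqP; rewrite -(@eqrXn2 _ 2) ?mulr_ge0 ?expR_ge0 ?sqrtr_ge0//
    ?divr_ge0 ?exprn_ge0 ?expR_ge0//.
  by apply/eqP; rewrite sqr_factE// [RHS]exprMn [(Num.sqrt _ * _) ^+ 2]exprMn sqr_sqrtr ?ltW.
by rewrite !invfM; ring.
Qed.

Theorem theorem4p3 (R : realType) (d : measure_display) (T : measurableType d)
    (P : probability T R) (lam : R) (N : seq nat -> {RV P >-> nat})
    (hlam : 0 < lam) (hN : poisson_galton_watson lam N) :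
  let Delta (w : T) : R := friendship_bias (fun u => N u w) in
  asymp_equiv (+oo : set_system R)
    (fun x : R => prob P [set w | x <= Delta w])
    (fun x : R => prob P [set w | N [::] w = 1%N] *
                  prob P [set w | x <= (N [:: 0%N] w)%:R])
  /\
  (* Both sides are compared at integer arguments x = n: P {Delta >= x} is
     asymptotically a step function, so the continuous expression on the
     right is not equivalent to it along real x. *)
  asymp_equiv \oo
    (fun n : nat => prob P [set w | n%:R <= Delta w])
    (fun n : nat => let x : R := n%:R in
       1 / Num.sqrt (2 * pi * x) * lam * expR (- (2 * lam)) *
       expR (- (x * ln (x / (lam * expR 1))))).
Proof.
move=> Delta; have main := friendship_bias_tail_equiv hlam hN.
split.
  apply: cvg_trans main; apply: near_eq_cvg; near=> x.
  have x0 : 0 < x by near: x; exact: nbhs_pinfty_gt.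
  congr (_ / _); rewrite -(hN.2 [::]) -(prob_offspring_ge hN [:: 0%N]).
  congr (_ * prob P _); apply/seteqP; split => w /=; by rewrite absz_ceil_le.
(* The real limit is restricted to integers, where the ceiling is the identity. *)
have mainn : asymp_equiv \oo (fun n : nat => prob P [set w | n%:R <= Delta w])
    (fun n => poisson_pmf lam 1 * poisson_tail lam n).
  have := cvg_comp _ _ (@cvgr_idn R) main; apply: cvg_trans.
  by apply: near_eq_cvg; apply: nearW => n /=; rewrite [n%:R]pmulrn intrKceil.
have tail := poisson_tail_equiv hlam.
have s0 : Num.sqrt (2 * pi) != 0 :> R by rewrite gt_eqF// sqrtr_gt0 mulr_gt0// pi_gt0.
have stir : Num.sqrt (2 * pi) / expR (stirling_log n) @[n --> \oo] -->
    (Num.sqrt (2 * pi) / Num.sqrt (2 * pi) : R).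
  apply: cvgM; first exact: cvg_cst.
  by apply: cvgV => //; exact: cvg_stirling_log.
rewrite divff// in stir.
rewrite /asymp_equiv.
(* Three ratios tending to 1 are multiplied: the [poisson_tail] factors cancel, and
   [expR (stirling_log n)] cancels against the one in [poisson_pmf_stirlingE], leaving
   [Num.sqrt (2 * pi)] in its place. *)
have := cvgM mainn (cvgM tail stir).
rewrite !mul1r => lim1; apply: cvg_trans (lim1 _ _); apply: near_eq_cvg.
exists 1%N => // n n0 /=.
have nR0 : 0 < n%:R :> R by rewrite ltr0n.
rewrite (poisson_pmf_stirlingE n hlam n0).
have p1 : poisson_pmf lam 1 = lam * expR (- lam).
  by rewrite /poisson_pmf hlam expr1 divr1.
rewrite p1 [Num.sqrt (2 * pi * _)]sqrtrM ?mulr_ge0 ?pi_ge0//.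
have -> : expR (- (2 * lam)) = expR (- lam) ^+ 2 by rewrite -expRM_natl mulrN.
have := poisson_tail_gt0 n hlam; set t := poisson_tail _ _ => t0.
have := expR_gt0 (- lam); set a := expR (- lam) => a0.
have := expR_gt0 (- (n%:R * ln (n%:R / (lam * expR 1)))); set b := expR _ => b0.
have := expR_gt0 (stirling_log n : R); set s := expR _ => ss0.
have : 0 < Num.sqrt n%:R :> R by rewrite sqrtr_gt0.
set r := Num.sqrt n%:R => r0.
by field; rewrite s0 !gt_eqF.
Unshelve. all: by end_near.
Qed.
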